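(* Let $A$ be a unital associative ring, $G$ an abelian group, $\sigma : G\to\operatorname{Aut}(A)$ a group homomorphism, and let $R=A\rtimes_\sigma G$ be the skew group ring. Suppose that $A$ is $G$-simple. Then every non-zero ideal of $R$ has non-empty intersection with $Z(R)\cap\big(1+\sum_{g\in G\setminus\{e\}} A u_g\big)$. In particular, $Z(R)$ has the ideal intersection property in $R$.
   Context: $G$ is written multiplicatively with neutral element $e$. The skew group ring $A \rtimes_\sigma G$ is the free left $A$-module with basis $\{u_g\}_{g\in G}$, with multiplication the biadditive extension of $(a u_g)(b u_h) = a\,\sigma_g(b)\, u_{gh}$ for $a,b\in A$, $g,h\in G$, where $\sigma_g := \sigma(g)$; its identity is $1 = 1_A u_e$. An ideal means a two-sided ideal. An ideal $I$ of $A$ is $G$-invariant if $\sigma_g(I)\subseteq I$ for all $g\in G$; $A$ is $G$-simple if $\{0\}$ and $A$ are its only $G$-invariant ideals. $Z(R)$ is the centre of $R$. The set $1+\sum_{g\in G\setminus\{e\}} A u_g$ consists of the elements of $R$ whose coefficient at $u_e$ is $1_A$. A subring $S$ of a ring $T$ has the ideal intersection property in $T$ if $S\cap I\neq\{0\}$ for each non-zero ideal $I$ of $T$. *)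

(* Defs.v *)
From HB Require Import structures.
From mathcomp Require Import all_boot all_order all_algebra.
From mathcomp Require Import finmap.
From mathcomp Require Import classical_sets.
From mathcomp.multinomials Require Import xfinmap monalg.

Set Implicit Arguments.
Unset Strict Implicit.
Unset Printing Implicit Defensive.

Import GRing.Theory.

Local Open Scope ring_scope.
Local Open Scope classical_set_scope.

Section Ideals.
Variable T : pzRingType.
Implicit Types I S : set T.

Definition ideal I : Prop :=
  [/\ I 0,
      forall x y, I x -> I y -> I (x - y),
      forall r x, I x -> I (r * x) &
      forall r x, I x -> I (x * r)].

Definition subring S : Prop :=
  [/\ S 1,
      forall x y, S x -> S y -> S (x - y) &
      forall x y, S x -> S y -> S (x * y)].

Definition center : set T := [set z | forall r, z * r = r * z].

Definition ideal_intersection_property S : Prop :=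
  forall I, ideal I -> I <> [set 0] -> S `&` I <> [set 0].

Lemma subring_center : subring center.
Proof.
split=> [r|x y xC yC r|x y xC yC r].
- by rewrite mul1r mulr1.
- by rewrite mulrBl mulrBr xC yC.
- by rewrite -mulrA yC mulrA xC mulrA.
Qed.

End Ideals.

Arguments center T : clear implicits.

(* A group homomorphism G -> Aut(A); that 1 acts trivially follows from
   bijectivity, see raut_one. *)
Record raut_action (G : groupType) (A : pzRingType) := RautAction {
  raut :> G -> {rmorphism A -> A};
  raut_bij : forall g, bijective (raut g);
  rautM : forall g h a, raut (g * h)%g a = raut g (raut h a)
}.

Lemma raut_one (G : groupType) (A : pzRingType) (sigma : raut_action G A) a :
  sigma 1%g a = a.
Proof.
by apply: (bij_inj (raut_bij sigma 1%g)); rewrite -rautM mulg1.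
Qed.

Section Invariant.
Variables (G : groupType) (A : pzRingType) (sigma : raut_action G A).

Definition G_invariant (I : set A) : Prop :=
  forall g, [set sigma g x | x in I] `<=` I.

Definition G_simple : Prop :=
  forall I : set A, ideal I -> G_invariant I -> I = [set 0] \/ I = [set: A].

End Invariant.

(* The finitely supported functions from G to A: x@_g is the coefficient of x
   at u_g, and << a *g g >> is a u_g. The parameter sigma only serves to attach
   the twisted multiplication to the type. *)
Definition skew_group_ring (G : groupType) (A : pzRingType)
  (sigma : raut_action G A) : Type := {malg A[G]}.

Section SkewGroupRing.
Variables (G : groupType) (A : pzRingType) (sigma : raut_action G A).

Local Notation R := (skew_group_ring sigma).

HB.instance Definition _ := GRing.Zmodule.on R.

Implicit Types (x y z : R) (a b : A) (g h : G).

Definition skew_scale a x : R := \sum_(g <- msupp x) << a * x@_g *g g >>.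

Lemma skew_scaleE a x g : (skew_scale a x)@_g = a * x@_g.
Proof.
rewrite {2}[x]monalgE !raddf_sum mulr_sumr.
by apply/eq_bigr=> /= i _; rewrite !mcoeffU mulrnAr.
Qed.

Lemma skew_scaleA a b x : skew_scale a (skew_scale b x) = skew_scale (a * b) x.
Proof. by apply/malgP=> g; rewrite !skew_scaleE mulrA. Qed.

Lemma skew_scale1 x : skew_scale 1 x = x.
Proof. by apply/malgP=> g; rewrite skew_scaleE mul1r. Qed.

Lemma skew_scaleDr a x y : skew_scale a (x + y) = skew_scale a x + skew_scale a y.
Proof. by apply/malgP=> g; rewrite mcoeffD !skew_scaleE mcoeffD mulrDr. Qed.

Lemma skew_scaleDl x a b : skew_scale (a + b) x = skew_scale a x + skew_scale b x.
Proof. by apply/malgP=> g; rewrite mcoeffD !skew_scaleE mulrDl. Qed.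

HB.instance Definition _ := GRing.Zmodule_isLmodule.Build A R
  skew_scaleA skew_scale1 skew_scaleDr skew_scaleDl.

Definition skew_basis g : R := << 1 *g g >>.

Definition skew_one : R := skew_basis 1%g.

Definition skew_mul x y : R :=
  \sum_(g <- msupp x) \sum_(h <- msupp y) << x@_g * sigma g (y@_h) *g (g * h)%g >>.

Lemma skew_mulw (d1 d2 : {fset G}) x y :
  fsubset (msupp x) d1 -> fsubset (msupp y) d2 ->
  skew_mul x y =
  \sum_(g <- d1) \sum_(h <- d2) << x@_g * sigma g (y@_h) *g (g * h)%g >>.
Proof.
move=> le_d1 le_d2; rewrite /skew_mul (big_fset_incl _ le_d1) /=.
  apply/eq_bigr=> g _; apply/big_fset_incl => // h _ /mcoeff_outdom ->.
  by rewrite rmorph0 mulr0 monalgU0.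
move=> g _ /mcoeff_outdom xg.
by rewrite big1 => // h _; rewrite xg mul0r monalgU0.
Qed.

Lemma skew_mulDl : left_distributive skew_mul +%R.
Proof.
move=> x y z.
rewrite (skew_mulw (msuppD_le _ _) (fsubset_refl _)).
rewrite (skew_mulw (fsubsetUl _ (msupp y)) (fsubset_refl (msupp z))).
rewrite (skew_mulw (fsubsetUr (msupp x) _) (fsubset_refl (msupp z))).
rewrite -big_split /=; apply/eq_bigr=> g _.
rewrite -big_split /=; apply/eq_bigr=> h _.
by rewrite mcoeffD mulrDl monalgUD.
Qed.

Lemma skew_mulDr : right_distributive skew_mul +%R.
Proof.
move=> x y z.
rewrite (skew_mulw (fsubset_refl _) (msuppD_le _ _)).
rewrite (skew_mulw (fsubset_refl _) (fsubsetUl _ (msupp z))).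
rewrite (skew_mulw (fsubset_refl _) (fsubsetUr (msupp y) _)).
rewrite -big_split /=; apply/eq_bigr=> g _.
rewrite -big_split /=; apply/eq_bigr=> h _.
by rewrite mcoeffD rmorphD mulrDr monalgUD.
Qed.

Lemma skew_mul0l x : skew_mul 0 x = 0.
Proof. by rewrite /skew_mul msupp0 big_seq_fset0. Qed.

Lemma skew_mul0r x : skew_mul x 0 = 0.
Proof.
by rewrite /skew_mul big1 // => g _; rewrite msupp0 big_seq_fset0.
Qed.

Lemma skew_mulUU a b g h :
  skew_mul << a *g g >> << b *g h >> = << a * sigma g b *g (g * h)%g >>.
Proof.
by rewrite (skew_mulw msuppU_le msuppU_le) !big_seq_fset1 !mcoeffUU.
Qed.

Lemma skew_mul_suml (s : seq G) (F : G -> R) x :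
  skew_mul (\sum_(g <- s) F g) x = \sum_(g <- s) skew_mul (F g) x.
Proof.
by rewrite (big_morph (skew_mul^~ x) (fun _ _ => skew_mulDl _ _ _) (skew_mul0l _)).
Qed.

Lemma skew_mul_sumr (s : seq G) (F : G -> R) x :
  skew_mul x (\sum_(g <- s) F g) = \sum_(g <- s) skew_mul x (F g).
Proof.
by rewrite (big_morph (skew_mul x) (fun _ _ => skew_mulDr _ _ _) (skew_mul0r _)).
Qed.

Lemma skew_mul1l : left_id skew_one skew_mul.
Proof.
move=> x; rewrite [in LHS](monalgE x) [RHS]monalgE skew_mul_sumr.
by apply/eq_bigr=> g _; rewrite skew_mulUU mul1r raut_one mul1g.
Qed.

Lemma skew_mul1r : right_id skew_one skew_mul.
Proof.
move=> x; rewrite [in LHS](monalgE x) [RHS]monalgE skew_mul_suml.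
by apply/eq_bigr=> g _; rewrite skew_mulUU rmorph1 mulr1 mulg1.
Qed.

Lemma skew_mulA : associative skew_mul.
Proof.
move=> x y z; rewrite (monalgE x).
rewrite (skew_mul_suml _ _ (skew_mul y z)) (skew_mul_suml _ _ y).
rewrite (skew_mul_suml _ _ z); apply/eq_bigr=> g _.
rewrite (monalgE y) (skew_mul_suml _ _ z) !(skew_mul_sumr _ _ << _ *g g >>).
rewrite (skew_mul_suml _ _ z); apply/eq_bigr=> h _.
rewrite (monalgE z) (skew_mul_sumr _ _ << _ *g h >>).
rewrite skew_mulUU !skew_mul_sumr; apply/eq_bigr=> k _.
by rewrite !skew_mulUU rmorphM mulrA rautM mulgA.
Qed.

HB.instance Definition _ := GRing.Zmodule_isPzRing.Build R
  skew_mulA skew_mul1l skew_mul1r skew_mulDl skew_mulDr.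

Lemma skew_basisE x : x = \sum_(g <- msupp x) x@_g *: skew_basis g.
Proof.
rewrite {1}[x]monalgE; apply: eq_bigr => g _; apply/malgP => h.
by rewrite [RHS]skew_scaleE !mcoeffU mulrnAr mulr1.
Qed.

Lemma skew_basisM a b g h :
  (a *: skew_basis g) * (b *: skew_basis h) =
  (a * sigma g b) *: skew_basis (g * h)%g.
Proof.
have E c k : c *: skew_basis k = << c *g k >> :> R.
  by apply/malgP => l; rewrite [LHS]skew_scaleE !mcoeffU mulrnAr mulr1.
by rewrite !E; apply: skew_mulUU.
Qed.

Lemma skew_oneE : 1 = skew_basis 1%g.
Proof. by []. Qed.

(* 1 + \sum_(g != e) A u_g *)
Definition one_plus_nonidentity : set R := [set x | x@_(1%g : G) = 1].

End SkewGroupRing.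

Arguments one_plus_nonidentity {G A} sigma _ : rename.

(* Main.v *)
Require Import Defs.
From mathcomp Require Import all_boot all_order all_algebra.
From mathcomp Require Import finmap.
From mathcomp Require Import boolp classical_sets.
From mathcomp.multinomials Require Import monalg.

Set Implicit Arguments.
Unset Strict Implicit.
Unset Printing Implicit Defensive.

Import GRing.Theory.

Local Open Scope ring_scope.
Local Open Scope classical_set_scope.

(** The proof is a minimal-support argument. Among the non-zero elements of the
    ideal [I] choose one with the fewest non-zero coefficients; after right
    multiplication by some [u_g] its coefficient at [u_e] is non-zero. Let [S]
    be its support. The coefficients at [u_e] of the elements of [I] supported
    in [S] form an ideal of [A], and since [G] is abelian conjugation by [u_g]
    acts on supports trivially, so that this ideal is [G]-invariant
    ([identity_coefs_ideal], [identity_coefs_invariant]). It is non-zero, hence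
    all of [A] by [G]-simplicity: some [y] in [I] supported in [S] has
    coefficient 1 at [u_e].

    Such a [y] is central. Indeed [a y - y a] for [a] in [A], and
    [u_g y u_g^-1 - y] for [g] in [G], lie in [I], are supported in [S], and
    vanish at [u_e]; their support is strictly smaller than [S], so they are
    zero by minimality. As [A] and the [u_g] generate the ring, [y] commutes
    with everything. *)

Lemma exists_minimizer (T : Type) (P : set T) (f : T -> nat) :
  P !=set0 -> exists2 x, P x & forall y, P y -> (f x <= f y)%N.
Proof.
move=> [x0 Px0].
have exn : exists n, `[< exists2 x, P x & f x = n >].
  by exists (f x0); apply/asboolP; exists x0.
case: (ex_minnP exn) => n /asboolP[x Px <-] min_x.
by exists x => // y Py; apply: min_x; apply/asboolP; exists y.
Qed.

Lemma ideal_neq0 (T : pzRingType) (I : set T) :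
  ideal I -> I <> [set 0] -> exists2 x, I x & x != 0.
Proof.
move=> [I0 _ _ _] In0; apply: contrapT => noI; apply: In0.
apply/seteqP; split=> [x Ix|_ ->//] /=.
by apply: contrapT => /eqP xn0; apply: noI; exists x.
Qed.

Section Coefficients.
Variables (G : groupType) (A : pzRingType) (sigma : raut_action G A).

Local Notation R := (skew_group_ring sigma).

Implicit Types (x y z : R) (a b : A) (g h : G).

(** As left translation by [g] is injective, only the term of [x] at [h]
    contributes to the coefficient at [g * h]. *)
Lemma skew_monomial_mulE a g x h :
  ((<< a *g g >> : R) * x)@_(g * h)%g = a * sigma g (x@_h).
Proof.
have -> : (<< a *g g >> : R) * x =
    \sum_(k <- msupp x) << a * sigma g (x@_k) *g (g * k)%g >>.
  rewrite {1}(monalgE x) [LHS]skew_mul_sumr; apply: eq_bigr => k _.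
  exact: skew_mulUU.
rewrite [in RHS](monalgE x) !raddf_sum mulr_sumr.
apply: eq_bigr => k _; rewrite /= !mcoeffU (inj_eq (mulgI g)).
by case: eqP; rewrite ?mulr1n ?mulr0n ?rmorph0 ?mulr0.
Qed.

Lemma skew_mul_monomialE a g x h :
  (x * (<< a *g g >> : R))@_(h * g)%g = x@_h * sigma h a.
Proof.
have -> : x * (<< a *g g >> : R) =
    \sum_(k <- msupp x) << x@_k * sigma k a *g (k * g)%g >>.
  rewrite {1}(monalgE x) [LHS]skew_mul_suml; apply: eq_bigr => k _.
  exact: skew_mulUU.
rewrite [in RHS](monalgE x) !raddf_sum mulr_suml.
apply: eq_bigr => k _; rewrite /= !mcoeffU (inj_eq (mulIg g)).
by case: eqP => [->|_]; rewrite ?mulr1n ?mulr0n ?mul0r.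
Qed.

Lemma skew_scalar_mulE a x h : ((<< a *g 1%g >> : R) * x)@_h = a * x@_h.
Proof. by rewrite -{1}(mul1g h) skew_monomial_mulE raut_one. Qed.

Lemma skew_mul_scalarE a x h :
  (x * (<< a *g 1%g >> : R))@_h = x@_h * sigma h a.
Proof. by rewrite -{1}(mulg1 h) skew_mul_monomialE. Qed.

(** The only use of commutativity of [G]: conjugation by [u_g] sends the
    coefficient at [h] to the index [g h g^-1], which is [h]. *)
Lemma skew_conjE (abelG : forall g h : G, (g * h = h * g)%g) g x h :
  (skew_basis sigma g * x * skew_basis sigma g^-1%g)@_h = sigma g (x@_h).
Proof.
have {1}-> : h = (g * h * g^-1)%g by rewrite abelG mulgA mulVg mul1g.
by rewrite skew_mul_monomialE skew_monomial_mulE rmorph1 mulr1 mul1r.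
Qed.

Lemma skew_basis_mulV g : skew_basis sigma g^-1%g * skew_basis sigma g = 1.
Proof. by rewrite [LHS]skew_mulUU rmorph1 mulr1 mulVg. Qed.

Lemma skew_basisZ a g :
  << a *g g >> = (<< a *g 1%g >> : R) * skew_basis sigma g.
Proof. by rewrite [RHS]skew_mulUU rmorph1 mulr1 mul1g. Qed.

(** Every element is a sum of products [a u_g], so commuting with both kinds of
    factors is enough. *)
Lemma skew_centralP y :
  (forall a, (<< a *g 1%g >> : R) * y = y * << a *g 1%g >>) ->
  (forall g, skew_basis sigma g * y = y * skew_basis sigma g) ->
  center R y.
Proof.
move=> yA yG r; rewrite (monalgE r).
rewrite [LHS]skew_mul_sumr [RHS]skew_mul_suml; apply: eq_bigr => g _.
rewrite skew_basisZ.
(* Fold the products left as [skew_mul] back into ring multiplication. *)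
change (y * ((<< r@_g *g 1%g >> : R) * skew_basis sigma g) =
  (<< r@_g *g 1%g >> : R) * skew_basis sigma g * y).
by rewrite mulrA -yA -!mulrA yG.
Qed.

(** The support of [x u_g] is a translate of that of [x], so moving a non-zero
    coefficient to [u_e] preserves minimality. *)
Lemma card_msupp_translate x g :
  (#|` msupp (x * skew_basis sigma g)| <= #|` msupp x|)%N.
Proof.
apply: (@leq_trans #|` [fset (h * g)%g | h in msupp x]%fset|); last first.
  exact: leq_imfset_card.
apply/fsubset_leq_card/fsubsetP => k; rewrite -mcoeff_neq0 => xk.
apply/imfsetP; exists (k * g^-1)%g; last by rewrite /= -mulgA mulVg mulg1.
rewrite /= -mcoeff_neq0; apply: contraNneq xk => xk.
by rewrite -[k](mulgVK g) skew_mul_monomialE xk mul0r.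
Qed.

End Coefficients.

Section IdentityCoefficients.
Variables (G : groupType) (A : pzRingType) (sigma : raut_action G A).

Local Notation R := (skew_group_ring sigma).

Definition supported_in (S : {fset G}) (x : R) : Prop :=
  forall h, h \notin S -> x@_h = 0.

Definition identity_coefs (I : set R) (S : {fset G}) : set A :=
  [set x@_(1%g : G) | x in I `&` supported_in S].

Variables (I : set R) (S : {fset G}).
Hypothesis idealI : ideal I.

Lemma identity_coefs_ideal : ideal (identity_coefs I S).
Proof.
case: idealI => I0 IB Il Ir; split.
- by exists 0; rewrite ?mcoeff0 //; split=> // h _; rewrite mcoeff0.
- move=> _ _ [x [Ix Sx] <-] [y [Iy Sy] <-]; exists (x - y); last exact: mcoeffB.
  by split; [exact: IB | move=> h Sh; rewrite mcoeffB Sx ?Sy ?subr0].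
- move=> a _ [x [Ix Sx] <-]; exists ((<< a *g 1%g >> : R) * x).
    by split; [exact: Il | move=> h Sh; rewrite skew_scalar_mulE Sx ?mulr0].
  exact: skew_scalar_mulE.
- move=> a _ [x [Ix Sx] <-]; exists (x * (<< a *g 1%g >> : R)).
    by split; [exact: Ir | move=> h Sh; rewrite skew_mul_scalarE Sx ?mul0r].
  by rewrite skew_mul_scalarE raut_one.
Qed.

Lemma identity_coefs_invariant (abelG : forall g h : G, (g * h = h * g)%g) :
  G_invariant sigma (identity_coefs I S).
Proof.
case: idealI => I0 IB Il Ir g _ [_ [x [Ix Sx] <-] <-].
exists (skew_basis sigma g * x * skew_basis sigma g^-1%g).
  split; first exact/Ir/Il.
  by move=> h Sh; rewrite skew_conjE // Sx ?rmorph0.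
exact: skew_conjE.
Qed.

End IdentityCoefficients.

Section CentralElement.
Variables (G : groupType) (A : pzRingType) (sigma : raut_action G A).
Hypothesis abelG : forall g h : G, (g * h = h * g)%g.

Local Notation R := (skew_group_ring sigma).

(** The last hypothesis is the form in which minimality of the support is used:
    an element supported in [S] and vanishing at [u_e] has fewer coefficients
    than [S] when [S] contains the identity of [G]. It is applied to
    [a y - y a] and to [u_g y u_g^-1 - y]; both vanish at [u_e] because [y] has
    coefficient 1 there. *)
Lemma central_of_rigid_support (I : set R) (S : {fset G}) (y : R) :
  ideal I -> I y -> supported_in S y -> y@_(1%g : G) = 1 ->
  (forall z, I z -> supported_in S z -> z@_(1%g : G) = 0 -> z = 0) ->
  center R y.
Proof.
move=> [I0 IB Il Ir] Iy Sy y1 rigid; apply: skew_centralP => [a|g].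
  apply/eqP; rewrite -subr_eq0; apply/eqP/rigid.
  - by apply: IB; [exact: Il | exact: Ir].
  - move=> h Sh.
    by rewrite mcoeffB skew_scalar_mulE skew_mul_scalarE Sy // mulr0 mul0r subr0.
  - rewrite mcoeffB skew_scalar_mulE skew_mul_scalarE y1 raut_one.
    by rewrite mulr1 mul1r subrr.
suff yJ : skew_basis sigma g * y * skew_basis sigma g^-1%g = y.
  by rewrite -{2}yJ -!mulrA skew_basis_mulV mulr1.
apply/eqP; rewrite -subr_eq0; apply/eqP/rigid.
- by apply: IB => //; apply/Ir/Il.
- by move=> h Sh; rewrite mcoeffB skew_conjE // Sy // rmorph0 subr0.
- by rewrite mcoeffB skew_conjE // y1 rmorph1 subrr.
Qed.

Lemma ideal_meets_center (simpleA : G_simple sigma) (I : set R) :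
  ideal I -> I <> [set 0] ->
  I `&` (center R `&` one_plus_nonidentity sigma) !=set0.
Proof.
move=> idealI /(ideal_neq0 idealI)[x0 Ix0 x0n0].
have [_ _ _ Ir] := idealI.
have [x [Ix xn0] min_x] :
    exists2 x, I x /\ x != 0 &
      forall y, I y /\ y != 0 -> (#|` msupp x| <= #|` msupp y|)%N.
  apply: (@exists_minimizer R [set x | I x /\ x != 0] (fun x => #|` msupp x|)).
  by exists x0.
have [g xg] : exists g, x@_g != 0.
  apply: contrapT => nog; move/eqP: xn0; apply; apply/malgP => g.
  by rewrite mcoeff0; apply: contrapT => /eqP xg; apply: nog; exists g.
pose w := x * skew_basis sigma g^-1%g.
pose S := msupp w.
have w1 : w@_(1%g : G) != 0.
  by rewrite -(mulgV g) skew_mul_monomialE rmorph1 mulr1.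
have rigid z : I z -> supported_in S z -> z@_(1%g : G) = 0 -> z = 0.
  move=> Iz Sz z1; apply: contrapT => /eqP zn0.
  have : (#|` S| <= #|` msupp z|)%N.
    by apply: leq_trans (min_x z _) => //; apply: card_msupp_translate.
  rewrite leqNgt => /negP; apply; apply: fproper_ltn_card.
  rewrite fproperE; apply/andP; split.
    by apply/fsubsetP=> h; rewrite -mcoeff_neq0; apply: contraNT => /Sz ->.
  apply/fsubsetPn; exists 1%g; first by rewrite -mcoeff_neq0.
  by rewrite -mcoeff_eq0 z1.
have [y [Iy Sy] y1] : identity_coefs I S 1.
  have [J0|->//] := simpleA _ (identity_coefs_ideal S idealI)
    (@identity_coefs_invariant _ _ _ I S idealI abelG).
  have : identity_coefs I S (w@_(1%g : G)).
    exists w => //; split; first exact: Ir.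
    by move=> h; apply: mcoeff_outdom.
  by rewrite J0 /= => /eqP; rewrite (negPf w1).
exists y; do 2!split=> //.
exact: central_of_rigid_support idealI Iy Sy y1 rigid.
Qed.

End CentralElement.

Theorem proposition4p2 (A : pzRingType) (G : groupType)
    (abelG : forall g h : G, (g * h = h * g)%g)
    (sigma : raut_action G A) (simpleA : G_simple sigma) :
  (forall I : set (skew_group_ring sigma), ideal I -> I <> [set 0] ->
     I `&` (center (skew_group_ring sigma) `&` one_plus_nonidentity sigma)
       !=set0) /\
  ideal_intersection_property (center (skew_group_ring sigma)).
Proof.
have meets := ideal_meets_center abelG simpleA.
split=> // I idealI In0 ZI0.
have [y [Iy [Zy y1]]] := meets I idealI In0.
have y0 : y = 0 by have : (center _ `&` I) y by []; rewrite ZI0.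
(* If 1 = 0 in [A], then the whole skew group ring is zero. *)
have [x _ /eqP] := ideal_neq0 idealI In0; apply; apply/malgP => g.
by move: y1; rewrite /one_plus_nonidentity /= y0 mcoeff0 => A0;
  rewrite mcoeff0 -[LHS]mul1r -A0 mul0r.
Qed.
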